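(* Let $\psi\in C^1(\mathbb{R})$ satisfy: $\psi(0)=1$, $\psi$ is even, there exist $C>0$ and $\delta>1$ with $|\psi(x)|+|x\psi'(x)|\leq C\langle x\rangle^{-\delta}$ for all $x\in\mathbb{R}$, and $A_\psi:=\int_{\mathbb{R}}\psi(x)\,\mathrm{d}x\neq 0$. Let $h(x)=\psi(x)+x\psi'(x)$ and $C_h=\int_{\mathbb{R}}|h(x)|^2\,\mathrm{d}x$. Let $\mu$ be a probability measure on $\mathbb{R}$ and $(c,d)$ a bounded interval. Then $$\lim_{a\downarrow0}a\int_c^d|W_h(\mu)(b,a)|^2\,\mathrm{d}b=C_h\Big(\sum_{x\in(c,d)}\mu(\{x\})^2+\tfrac12\big(\mu(\{c\})^2+\mu(\{d\})^2\big)\Big).$$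
   Context: $\langle x\rangle=(1+x^2)^{1/2}$. The continuous wavelet transform of $\mu$ is $W_h(\mu)(b,a)=\frac1a\int_{-\infty}^{\infty}h((b-y)/a)\,\mathrm{d}\mu(y)$ for $b\in\mathbb{R}$, $a>0$. *)

(* Defs.v *)
From HB Require Import structures.
From mathcomp Require Import all_boot all_order all_algebra.
From mathcomp Require Import all_classical all_reals all_analysis.
Set Implicit Arguments. Unset Strict Implicit. Unset Printing Implicit Defensive.
Import Order.TTheory GRing.Theory Num.Theory.
Import numFieldNormedType.Exports.
Local Open Scope classical_set_scope.
Local Open Scope ring_scope.

Definition jbr {R : realType} (x : R) : R := Num.sqrt (1 + x ^+ 2).

Definition hfun {R : realType} (psi : R -> R) (x : R) : R :=
  psi x + x * derive1 psi x.

Definition Cconst {R : realType} (h : R -> R) : R :=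
  Rintegral (@lebesgue_measure R) setT (fun x => `|h x| ^+ 2).

Definition cwt {R : realType} (h : R -> R) (mu : probability R R) (b a : R) : R :=
  a^-1 * Rintegral mu setT (fun y => h ((b - y) / a)).

(* Main.v *)
(**
With [avg a b = \int h ((b - z) / a) dmu(z)], expanding one factor of [avg a b ^+ 2],
Fubini and the substitution [b = y + a t] turn the rescaled energy into
[\int dmu(y) \int 1_(c,d)(y + a t) h(t) avg a (y + a t) dt].
As [a] decreases to 0, [avg a (y + a t) --> h(t) mu{y}] by dominated convergence,
because [h] vanishes at infinity, while the indicator tends to 1 for [y] inside
[(c,d)] and to the indicator of a half-line of [t] for [y] an endpoint; evenness
of [h] gives each endpoint half of [\int h ^+ 2].  Two further dominated
convergences leave [\int mu{y} dmu(y)], a sum over the atoms of [mu].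
*)
Require Import Defs.
From HB Require Import structures.
From mathcomp Require Import all_boot all_order all_algebra.
From mathcomp Require Import all_classical all_reals all_analysis.
From mathcomp Require Import measurable_realfun.
From mathcomp Require Import finmap ring lra.
Import Order.TTheory GRing.Theory Num.Theory.
Import numFieldNormedType.Exports.
Local Open Scope classical_set_scope.
Local Open Scope ring_scope.

(** * Dominated convergence for real integrals and affine substitution *)

Lemma Rintegral_dominated_cvg d (T : measurableType d) (R : realType)
    (m : {measure set T -> \bar R}) (f_ : (T -> R)^nat) (f g : T -> R) :
  (forall n, measurable_fun setT (f_ n)) ->
  (forall x, f_ ^~ x @ \oo --> f x) ->
  m.-integrable setT (EFin \o g) ->
  (forall n x, `|f_ n x| <= g x) ->
  m.-integrable setT (EFin \o f) /\
  Rintegral m setT (f_ n) @[n --> \oo] --> Rintegral m setT f.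
Proof.
move=> mf_ ff ig fg.
have mf : measurable_fun setT f.
  by apply: (@measurable_fun_cvg _ _ _ _ f_) => // x _; exact: ff.
have [|||||intf _ cvgf] := @dominated_convergence _ T R m setT measurableT
    (fun n x => (f_ n x)%:E) (EFin \o f) (EFin \o g).
- by move=> n; exact/measurable_EFinP.
- exact/measurable_EFinP.
- by apply: aeW => x _; apply: cvg_EFin; [exact: nearW|exact: ff].
- exact: ig.
- by apply: aeW => x n _; rewrite lee_fin.
split; first exact: intf.
apply: fine_cvg; rewrite fineK//.
exact: integrable_fin_num.
Qed.

(** By uniqueness of Lebesgue measure it suffices that [a] times the pushforward under
    [t |-> y + a * t] gives each interval []u, v]] its length; the preimage of that interval has
    length [(v - u) / a]. *)
Lemma lebesgue_measure_affine (R : realType) (y a : R) (a0 : 0 < a) (A : set R) :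
  measurable A ->
  lebesgue_measure A = (a%:E * lebesgue_measure ((fun t => y + a * t)%R @^-1` A))%E.
Proof.
move=> mA; pose phi : measurableTypeR R -> measurableTypeR R := fun t => y + a * t.
have mphi : measurable_fun setT phi by apply: measurable_funD.
pose phiM : {mfun measurableTypeR R >-> measurableTypeR R} :=
  HB.pack phi (isMeasurableFun.Build _ _ _ _ phi mphi).
rewrite [LHS](@lebesgue_measure_unique R
  (mscale (NngNum (ltW a0)) (pushforward lebesgue_measure phiM)))//.
move=> _ [[u v]] _ <- /=; rewrite /mscale/= /pushforward/=.
have -> : phi @^-1` `]u, v] = `](u - y) / a, (v - y) / a]%classic.
  apply/seteqP; split=> x; rewrite /phi/= !in_itv/=.
    by rewrite ltr_pdivrMr// ler_pdivlMr// => /andP[? ?]; apply/andP; split; lra.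
  by rewrite ltr_pdivrMr// ler_pdivlMr// => /andP[? ?]; apply/andP; split; lra.
rewrite !lebesgue_measure_itv/= !lte_fin ltr_pM2r ?invr_gt0// ltrD2r.
case: ifPn => uv; last by rewrite mule0.
by rewrite -EFinB -EFinM; congr EFin; field; rewrite gt_eqF.
Qed.

Lemma ge0_integral_affine (R : realType) (y a : R) (a0 : 0 < a) (f : R -> \bar R) :
  measurable_fun setT f -> (forall x, 0 <= f x)%E ->
  (\int[lebesgue_measure]_x f x =
   a%:E * \int[lebesgue_measure]_t f (y + a * t)%R)%E.
Proof.
move=> mf f0; pose phi : measurableTypeR R -> measurableTypeR R := fun t => y + a * t.
have mphi : measurable_fun setT phi by apply: measurable_funD.
pose phiM : {mfun measurableTypeR R >-> measurableTypeR R} :=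
  HB.pack phi (isMeasurableFun.Build _ _ _ _ phi mphi).
rewrite (eq_measure_integral
  (mscale (NngNum (ltW a0)) (pushforward lebesgue_measure phiM))); last first.
  by move=> A mA _; exact: (lebesgue_measure_affine _ y _ a0).
by rewrite ge0_integral_mscale//= ge0_integral_pushforward// preimage_setT.
Qed.

Lemma integrable_affine (R : realType) (y a : R) (a0 : 0 < a) (f : R -> R) :
  lebesgue_measure.-integrable setT (EFin \o f) ->
  lebesgue_measure.-integrable setT (EFin \o (fun t => f (y + a * t))).
Proof.
move=> /integrableP[mf intf]; apply/integrableP; split.
  apply: (measurableT_comp mf); exact: measurable_funD.
have := intf; rewrite (ge0_integral_affine _ y _ a0)//; last exact: measurableT_comp.
(* Writing [+oo] as [a * +oo] puts the factor [a] on both sides, where it can be cancelled. *)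
rewrite -[X in (_ < X)%E -> _](@gt0_muley _ a%:E) ?lte_fin//.
by rewrite lte_pmul2l ?lte_fin.
Qed.

(** The nonnegative substitution is applied to the positive and negative parts separately;
    integrability lets the factor [a] distribute over their difference. *)
Lemma Rintegral_affine (R : realType) (y a : R) (a0 : 0 < a) (f : R -> R) :
  lebesgue_measure.-integrable setT (EFin \o f) ->
  Rintegral lebesgue_measure setT f =
  a * Rintegral lebesgue_measure setT (fun t => f (y + a * t)).
Proof.
move=> intf; have mf := measurable_int _ intf.
have intg := integrable_affine _ y _ a0 _ intf.
rewrite -RintegralZl// /Rintegral; congr fine.
under [RHS]eq_integral do rewrite EFinM.
rewrite integralZl// [in LHS]integralE [in RHS]integralE muleBr//; last first.
  by apply: fin_num_adde_defr; exact: (integrable_pos_fin_num measurableT intg).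
congr (_ - _)%E.
- rewrite (ge0_integral_affine _ y _ a0)//; last exact: measurable_funepos.
  congr (_ * _)%E; apply: eq_integral => t _.
  by rewrite (funepos_comp (EFin \o f) (fun t => y + a * t)%R).
- rewrite (ge0_integral_affine _ y _ a0)//; last exact: measurable_funeneg.
  congr (_ * _)%E; apply: eq_integral => t _.
  by rewrite (funeneg_comp (EFin \o f) (fun t => y + a * t)%R).
Qed.

(** * Integrability of negative powers of the bracket [jbr] *)

Lemma cvgy_powR (R : realType) (p : R) : 0 < p -> x `^ p @[x --> +oo] --> +oo.
Proof.
move=> p0; apply/cvgryPge => A; near=> x.
have M0 : 0 <= Num.max A 1 by rewrite le_max ler01 orbT.
(* Replacing [A] by [Num.max A 1] makes the target nonnegative, so that it is the [p]-th power of
   its [p]-th root. *)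
apply: (@le_trans _ _ (Num.max A 1)); first by rewrite le_max lexx.
have -> : Num.max A 1 = (Num.max A 1 `^ p^-1) `^ p.
  by rewrite -powRrM mulVf ?gt_eqF// powRr1.
have x0 : 0 <= x by near: x; exact: nbhs_pinfty_ge.
have xA : Num.max A 1 `^ p^-1 <= x by near: x; exact: nbhs_pinfty_ge.
by apply: ge0_ler_powR => //; rewrite ?nnegrE ?powR_ge0 // ltW.
Unshelve. all: by end_near. Qed.

Lemma integral_onem_powR_lty (R : realType) (delta : R) : 1 < delta ->
  (\int[lebesgue_measure]_(x in `[0%R, +oo[) ((1 + x) `^ (- delta))%:E < +oo)%E.
Proof.
move=> d1; have d0 : 0 < delta - 1 by rewrite subr_gt0.
have dF (x : R) : 0 <= x -> is_derive x 1 (fun x => - (delta - 1)^-1 * (1 + x) `^ (1 - delta))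
    ((1 + x) `^ (- delta)).
  move=> x0; have x1 : 0 < 1 + x by rewrite ltr_pwDl.
  have D1 : is_derive x 1 (fun x : R => 1 + x) 1.
    by have := is_deriveD (is_derive_cst (1 : R) x 1) (is_derive_id x (1:R)); rewrite add0r.
  have D2 := is_derive1_powR (1 - delta) x1.
  have := @is_derive1_comp _ (fun z : R => z `^ (1 - delta)) (fun x : R => 1 + x) x _ _ D2 D1.
  move=> D3; have := is_deriveZ (- (delta - 1)^-1) D3.
  rewrite mulr1 (_ : _ *: _ = (1 + x) `^ (- delta))//.
  rewrite /GRing.scale/= mulrA (_ : 1 - delta - 1 = - delta); last by ring.
  rewrite (_ : - (delta - 1)^-1 * (1 - delta) = 1) ?mul1r//.
  by rewrite -(opprB delta 1) mulrNN mulVf// gt_eqF.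
have cF (x : R) : 0 <= x ->
    {for x, continuous (fun x : R => - (delta - 1)^-1 * (1 + x) `^ (1 - delta))}.
  by move=> x0; apply/differentiable_continuous/derivable1_diffP; have [] := dF _ x0.
have cf (x : R) : 0 <= x -> {for x, continuous (fun x : R => (1 + x) `^ (- delta))}.
  move=> x0; apply: (@continuous_comp _ _ _ (fun x : R => 1 + x) (fun z => z `^ (- delta))).
    by apply: continuousD; [exact: cvg_cst|exact: cvg_id].
  apply/differentiable_continuous/derivable1_diffP.
  by apply: derivable_powR; rewrite in_itv/= andbT ltr_pwDl.
have pos : \forall x \near +oo, 0 < (1 + x : R) `^ (delta - 1).
  near=> x; have x0 : 0 <= x by near: x; exact: nbhs_pinfty_ge.
  by apply: powR_gt0; rewrite ltr_pwDl.
have cp : (1 + x : R) `^ (delta - 1) @[x --> +oo] --> +oo.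
  apply: (cvg_comp (fun x : R => 1 + x) (fun x => x `^ (delta - 1))); last exact: cvgy_powR.
  apply/cvgryPge => A; near=> x; rewrite -lerBlDl; near: x.
  by apply: nbhs_pinfty_ge; exact: num_real.
rewrite (@ge0_continuous_FTC2y _ _
   (fun x => - (delta - 1)^-1 * (1 + x) `^ (1 - delta)) 0 0).
- by rewrite ltry.
- by move=> x _; exact: powR_ge0.
- apply/continuous_within_itvcyP; split.
    by move=> x; rewrite in_itv/= andbT => x0; apply: cf; exact: ltW.
  by apply/cvg_at_right_filter; exact: cf.
- rewrite -[X in _ --> X](mulr0 (- (delta - 1)^-1)); apply: cvgM; first exact: cvg_cst.
  rewrite (_ : (fun x : R => _) = (fun x => ((1 + x) `^ (delta - 1))^-1)); last first.
    by apply/funext => x; rewrite -powRN opprB.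
  apply: (iffRL (gtr0_cvgV0 _)).
    exact: pos.
  exact: cp.
- by move=> x x0; have [] := dF x (ltW x0).
- by apply/cvg_at_right_filter; exact: cF.
- by move=> x; rewrite in_itv/= andbT => x0; rewrite derive1E; have [_ ->] := dF x (ltW x0).
Unshelve. all: by end_near. Qed.

Lemma jbr_ge1 (R : realType) (x : R) : 1 <= jbr x.
Proof. by rewrite /jbr -[leLHS]sqrtr1 ler_wsqrtr// lerDl sqr_ge0. Qed.

Lemma jbr_ge_norm (R : realType) (x : R) : `|x| <= jbr x.
Proof. by rewrite /jbr -sqrtr_sqr ler_wsqrtr// lerDr. Qed.

Lemma continuous_jbr (R : realType) : continuous (@jbr R).
Proof.
move=> x; apply: (@continuous_comp _ _ _ (fun x : R => 1 + x ^+ 2) Num.sqrt);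
  last exact: sqrt_continuous.
by apply: continuousD; [exact: cvg_cst|exact: exprn_continuous].
Qed.

Lemma integrable_jbr_powR (R : realType) (delta : R) : 1 < delta ->
  lebesgue_measure.-integrable [set: R] (fun x => (jbr x `^ (- delta))%:E).
Proof.
move=> d1; have j0 (x : R) : 0 < jbr x by rewrite (lt_le_trans ltr01)// jbr_ge1.
have cj : continuous (fun x : R => jbr x `^ (- delta)).
  move=> x; apply: (@continuous_comp _ _ _ (@jbr R) (fun z => z `^ (- delta))).
    exact: continuous_jbr.
  apply/differentiable_continuous/derivable1_diffP.
  by apply: derivable_powR; rewrite in_itv/= andbT.
have mj : measurable_fun setT (fun x : R => jbr x `^ (- delta)).
  exact: continuous_measurable_fun.
apply/integrableP; split; first exact/measurable_EFinP.
under eq_integral do rewrite /= ger0_norm ?powR_ge0//.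
rewrite ge0_symfun_integralT//; last 2 first.
  by move=> x; exact: powR_ge0.
  by move=> x; rewrite /= /jbr sqrrN.
rewrite lte_mul_pinfty//.
rewrite -set_itvcy.
have mp : measurable_fun (`[0, +oo[%classic : set R) (fun x : R => (1 + x) `^ (- delta)).
  apply: measurable_funTS; apply: (measurableT_comp (measurable_powR _)) => //.
  exact: measurable_funD.
apply: (@le_lt_trans _ _ (\int[lebesgue_measure]_(x in `[0%R, +oo[)
    ((2^-1 `^ (- delta))%:E * ((1 + x) `^ (- delta))%:E))%E).
  apply: ge0_le_integral => //.
  - by move=> x _; rewrite lee_fin powR_ge0.
  - by apply/measurable_EFinP; apply: measurable_funTS.
  - rewrite (_ : (fun _ => _) = EFin \o (fun x : R => 2^-1 `^ (- delta) * (1 + x) `^ (- delta)))//.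
    by apply/measurable_EFinP; exact: measurable_funM.
  move=> x; rewrite /= in_itv/= andbT => x0; rewrite -EFinM lee_fin -powRM ?invr_ge0//; last lra.
  rewrite !powRN lef_pV2 ?posrE ?powR_gt0//; last by lra.
  apply: ge0_ler_powR; rewrite ?nnegrE ?(ltW (j0 _))//; try lra.
  have jj := jbr_ge1 _ x; have := jbr_ge_norm _ x; rewrite ger0_norm//; lra.
rewrite ge0_integralZl//.
- by rewrite lte_mul_pinfty ?lee_fin ?powR_ge0// integral_onem_powR_lty.
- exact/measurable_EFinP.
- by move=> x _; rewrite lee_fin powR_ge0.
Qed.

(** * Atoms of a probability measure *)

Lemma finite_atoms_gt (R : realType) (mu : probability R R) (e : R) : 0 < e ->
  finite_set [set x | (e%:E < mu [set x])%E].
Proof.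
(* Otherwise one could pick more than [1 / e] such points, whose total mass would exceed 1. *)
move=> e0; apply: contrapT => /(infinite_set_fset (Num.truncn e^-1).+1)[B BA cB].
have : (mu [set` B] <= 1)%E.
  apply: probability_le1; apply: countable_measurable => //.
  by apply: finite_set_countable; exact: finite_fset.
rewrite leNgt => /negP; apply.
have -> : mu [set` B] = (\sum_(x <- B) mu [set x])%E.
  rewrite -[X in mu X]image_id -(bigcup_imset1 _ id) bigcup_fset measure_fbigsetU//=.
  by move=> i j _ _ [z [/= -> ->]].
apply: (@lt_le_trans _ _ (\sum_(x <- B) e%:E)%E); last first.
  by rewrite big_seq [leRHS]big_seq; apply: lee_sum => x xB; exact/ltW/BA.
rewrite sumEFin lte_fin big_const_seq iter_addr addr0 count_predT -mulr_natr -ltr_pdivrMl// mulr1.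
by rewrite (lt_le_trans (truncnS_gt _))// ler_nat.
Qed.

(** The diagonal of the plane is measurable, being the zero set of subtraction, and [mu [set x]] is
    the mass of its section at [x]. *)
Lemma measurable_atom_mass (R : realType) (mu : probability R R) :
  measurable_fun setT (fun x : R => mu [set x]).
Proof.
pose D := [set xy : R * R | xy.1 - xy.2 = 0].
have mD : measurable D.
  have : measurable_fun setT (fun xy : R * R => xy.1 - xy.2) by exact: measurable_funB.
  by move/(_ measurableT [set 0] (measurable_set1 0)); rewrite setTI.
have := measurable_fun_xsection mu mD; congr measurable_fun.
apply/funext => x /=; congr (mu _); apply/seteqP; split => y.
  by move=> /xsectionP /eqP; rewrite /= subr_eq0 => /eqP.
by move=> /= ->; apply/xsectionP; rewrite /D/= subrr.
Qed.

Lemma integral_finite_set (R : realType) (mu : probability R R) (f : R -> \bar R) (A : set R) :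
  finite_set A -> measurable_fun setT f -> (forall x, 0 <= f x)%E ->
  (\int[mu]_(x in A) f x = \sum_(x \in A) f x * mu [set x])%E.
Proof.
move=> finA mf f0; rewrite fsbig_finite//=.
have {1}-> : A = \big[setU/set0]_(x <- fset_set A) [set x].
  by rewrite bigsetU_fset_set// bigcup_imset1 image_id.
rewrite ge0_integral_bigsetU//; last 2 first.
- by move=> i j _ _ [z [/= -> ->]].
- exact: measurable_funTS.
apply: eq_bigr => x _; rewrite -integral_cst//.
by apply: eq_integral => y /set_mem ->.
Qed.

(** On a finite set the integral is a finite sum, so finite subsets of [I] give one inequality. For
    the other, the integrand vanishes on [I] outside the increasing union of the finite sets of
    atoms heavier than [1 / (n + 1)], and monotone convergence applies. *)
Lemma integral_atom_mass (R : realType) (mu : probability R R) (I : set R) :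
  measurable I ->
  (\int[mu]_(x in I) mu [set x] = \esum_(x in I) (mu [set x] * mu [set x]))%E.
Proof.
move=> mI; have mm := measurable_atom_mass _ mu.
have m0 (x : R) : (0 <= mu [set x])%E by [].
apply/eqP; rewrite eq_le; apply/andP; split; last first.
  apply: ge_ereal_sup => _ [X [finX XI] <-].
  rewrite -integral_finite_set//; apply: ge0_subset_integral => //.
    by apply: countable_measurable => //; apply: finite_set_countable.
  exact: measurable_funTS.
pose F n := I `&` [set x | ((n.+1%:R^-1)%:E < mu [set x])%E].
have finF n : finite_set (F n).
  by apply: finite_setIr; apply: finite_atoms_gt; rewrite invr_gt0.
have mF n : measurable (F n).
  by apply: countable_measurable => //; apply: finite_set_countable.
have ndF : nondecreasing_seq F.
  move=> m n mn; apply/subsetPset => x [Ix xm]; split => //=.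
  by apply: le_lt_trans xm; rewrite lee_fin lef_pV2 ?posrE// ler_nat ltnS.
have <- : (\int[mu]_(x in \bigcup_n F n) mu [set x] = \int[mu]_(x in I) mu [set x])%E.
  rewrite integral_mkcond [RHS]integral_mkcond; apply: eq_integral => x _.
  rewrite !patchE; case: ifPn => xF; case: ifPn => xI //.
    by move: xF => /set_mem[n _ [Ix _]]; move: xI; rewrite notin_setE => /(_ Ix).
  apply/eqP; rewrite eq_sym eq_le m0 andbT leNgt; apply/negP => mx.
  have fx : mu [set x] \is a fin_num by exact: fin_num_measure.
  have fx0 : 0 < fine (mu [set x]) by rewrite -lte_fin fineK.
  move: xF; rewrite notin_setE; apply.
  (* With [n] the integer part of [1 / mu{x}], one has [n + 1 > 1 / mu{x}], so [x] lies in [F n]. *)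
  exists (Num.truncn (fine (mu [set x]))^-1) => //; split; first exact: set_mem.
  by rewrite /= -(fineK fx) lte_fin invf_plt ?posrE// truncnS_gt.
have cvF := @ge0_nondecreasing_set_cvg_integral _ _ R F (fun x => mu [set x]) mu ndF mF
  (fun n => measurable_funTS mm) (fun _ _ _ => m0 _).
apply: cvge_le cvF; near=> n.
rewrite integral_finite_set//; apply: ereal_sup_ubound.
by exists (F n) => //; split => //; exact: subIsetl.
Unshelve. all: by end_near. Qed.

(** * Fubini under a one-variable bound, and integrability rules *)

Lemma Fubini_dominated {d1 d2} {T1 : measurableType d1} {T2 : measurableType d2} {R : realType}
    (m1 : {sigma_finite_measure set T1 -> \bar R}) (m2 : probability T2 R)
    (f : T1 * T2 -> R) (g : T1 -> R) :
  measurable_fun setT f -> m1.-integrable setT (EFin \o g) ->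
  (forall x y, `|f (x, y)| <= g x) ->
  [/\ measurable_fun setT (fun x => Rintegral m2 setT (fun y => f (x, y))),
      measurable_fun setT (fun y => Rintegral m1 setT (fun x => f (x, y))) &
      Rintegral m1 setT (fun x => Rintegral m2 setT (fun y => f (x, y))) =
      Rintegral m2 setT (fun y => Rintegral m1 setT (fun x => f (x, y)))].
Proof.
move=> mf ig fg.
have mfE : measurable_fun setT (EFin \o f) by exact/measurable_EFinP.
have mg := measurable_int _ ig.
have g0 x : 0 <= g x by apply: le_trans (fg x point).
(* Since [m2] has total mass 1, integrating the bound [g x] over the second variable returns [g x],
   so the double integral of [|f|] is at most the integral of [g]. *)
have intf : (m1 \x m2)%E.-integrable setT (EFin \o f).
  apply/integrable12ltyP => //.
  apply: (@le_lt_trans _ _ (\int[m1]_x (g x)%:E)%E).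
    apply: ge0_le_integral => //.
    - by move=> x _; apply: integral_ge0.
    - apply: (measurable_fun_fubini_tonelli_F (abse \o (EFin \o f))) => //=.
      exact: measurableT_comp.
    move=> x _; apply: (@le_trans _ _ (\int[m2]_y (g x)%:E)%E).
      apply: ge0_le_integral => //.
      + by apply: measurableT_comp => //; exact: measurableT_comp mfE _.
      + by move=> y _; rewrite lee_fin.
    by rewrite integral_cst// [X in (_ * X)%E]probability_setT mule1.
  move/integrableP : ig => [_]; apply: le_lt_trans.
  apply: ge0_le_integral => //; first by move=> x _; rewrite lee_fin.
    exact: measurableT_comp.
  by move=> x _; rewrite lee_fin ler_norm.
(* The bound holds at every point, so every slice is integrable and [fine] discards nothing when
   passing between real and extended integrals. *)
have i1 y : m1.-integrable setT (EFin \o (fun x => f (x, y))).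
  apply: le_integrable ig => //; first exact: measurableT_comp mfE _.
  by move=> x _; rewrite lee_fin (le_trans (fg _ _))// ler_norm.
have i2 x : m2.-integrable setT (EFin \o (fun y => f (x, y))).
  apply: (@le_integrable _ _ _ _ _ measurableT _ (EFin \o cst (g x))) => //.
  - exact: measurableT_comp mfE _.
  - by move=> y _; rewrite lee_fin (le_trans (fg _ _))// ler_norm.
  - by apply: finite_measure_integrable_cst.
split.
- apply/measurable_EFinP; have := measurable_fubini_F intf; congr measurable_fun.
  apply/funext => x; rewrite /= /Rintegral fineK//.
  exact: (integrable_fin_num measurableT (i2 x)).
- apply/measurable_EFinP; have := measurable_fubini_G intf; congr measurable_fun.
  apply/funext => x; rewrite /= /Rintegral fineK//.
  exact: (integrable_fin_num measurableT (i1 x)).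
rewrite /Rintegral; congr fine; have := Fubini intf.
move=> F; transitivity (\int[m1]_x \int[m2]_y (f (x, y))%:E)%E.
  apply: eq_integral => x _; rewrite fineK//.
  exact: (integrable_fin_num measurableT (i2 x)).
rewrite F; apply: eq_integral => y _.
rewrite fineK//; exact: (integrable_fin_num measurableT (i1 y)).
Qed.

Lemma integrable_bounded {d} {T : measurableType d} {R : realType}
    (mu : {finite_measure set T -> \bar R}) (f : T -> R) (B : R) : measurable_fun setT f ->
  (forall x, `|f x| <= B) -> mu.-integrable setT (EFin \o f).
Proof.
move=> mf fB; apply: (@le_integrable _ _ _ _ _ measurableT _ (EFin \o cst B)) => //.
- exact/measurable_EFinP.
- by move=> x _; rewrite lee_fin (le_trans (fB _))// ler_norm.
- exact: finite_measure_integrable_cst.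
Qed.

Lemma integrable_EFinZl {d} {T : measurableType d} {R : realType}
    (m : {measure set T -> \bar R}) (k : R) (f : T -> R) :
  m.-integrable setT (EFin \o f) -> m.-integrable setT (EFin \o (fun t => k * f t)).
Proof.
by move=> intf; rewrite (_ : _ \o _ = fun t => (k%:E * (f t)%:E)%E)//; exact: integrableZl.
Qed.

Lemma integrable_EFinD {d} {T : measurableType d} {R : realType}
    (m : {measure set T -> \bar R}) (f g : T -> R) :
  m.-integrable setT (EFin \o f) -> m.-integrable setT (EFin \o g) ->
  m.-integrable setT (EFin \o (fun t => f t + g t)).
Proof.
move=> intf intg.
by rewrite (_ : _ \o _ = fun t => ((f t)%:E + (g t)%:E)%E)//; exact: integrableD.
Qed.

(** The sequence is eventually constant. Away from the endpoints [y + u n * t] ends up on the same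
    side of [c] and [d] as [y]; at an endpoint the sign of [t] decides, and [t = 0] gives 0 because
    the interval is open. *)
Lemma cvg_indic_itvoo (R : realType) (c d y t : R) (u : R^nat) : c < d ->
  (forall n, 0 < u n) -> u n @[n --> \oo] --> 0 ->
  (\1_(`]c, d[%classic) (y + u n * t) : R) @[n --> \oo] -->
  (\1_(`]c, d[%classic) y + \1_[set c] y * \1_(`]0, +oo[%classic) t
  + \1_[set d] y * \1_(`]-oo, 0[%classic) t : R).
Proof.
move=> cd u0 u_0.
have yu : y + u n * t @[n --> \oo] --> y.
  rewrite -[X in _ --> X]addr0 -(mul0r t); apply: cvgD; first exact: cvg_cst.
  by apply: cvgM => //; exact: cvg_cst.
(* Allows the implications below to be required of one [n] before the position of [y] is known: a
   false premise costs nothing. *)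
have ev (P : bool) (b : nat -> bool) : (P -> \forall n \near \oo, b n) ->
    \forall n \near \oo, P -> b n.
  by case: P => [h|_]; [near do move=> _; exact: h|exact: nearW].
apply: cvg_near_cst; near=> n; apply/eqP.
have H1 : c < y -> c < y + u n * t.
  by near: n; apply: ev => ?; exact: (cvgr_gt _ yu).
have H2 : y < d -> y + u n * t < d.
  by near: n; apply: ev => ?; exact: (cvgr_lt _ yu).
have H3 : y < c -> y + u n * t < c.
  by near: n; apply: ev => ?; exact: (cvgr_lt _ yu).
have H4 : d < y -> d < y + u n * t.
  by near: n; apply: ev => ?; exact: (cvgr_gt _ yu).
have un := u0 n.
rewrite !indicE !mem_setE !in_itv/= andbT.
have s1 a : (y \in [set a]) = (y == a) by apply/idP/eqP => [/set_mem//|->]; exact/mem_set.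
rewrite !s1; have [yc|yc] := eqVneq y c; [|have [yd|yd] := eqVneq y d].
- by subst y; rewrite ltxx (lt_eqF cd) ltrDl pmulr_rgt0// mul0r addr0 add0r mul1r (H2 cd) andbT.
- by subst y; rewrite ltxx andbF mul0r mul1r !add0r gtrDl pmulr_rlt0// (H1 cd).
rewrite !mul0r !addr0; move: yc yd; rewrite !neq_lt => /orP[yc|yc] /orP[yd|yd].
- by rewrite (lt_gtF (H3 yc)) (lt_gtF yc).
- by rewrite (lt_gtF (H3 yc)) (lt_gtF yc).
- by rewrite (H1 yc) (H2 yd) yc yd.
- by rewrite (lt_gtF (H4 yd)) (lt_gtF yd) !andbF.
Unshelve. all: by end_near. Qed.

(** * Local energy asymptotics for a general even kernel [h] *)

Section wavelet_energy.
Context {R : realType} (h : R -> R) (M : R) (mu : probability R R) (c d : R).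
Hypotheses (ch : continuous h) (h_le : forall x, `|h x| <= M)
  (xh_le : forall x, `|x * h x| <= M) (h_even : forall x, h (- x) = h x)
  (ih : lebesgue_measure.-integrable [set: R] (EFin \o h)) (cd : c < d).

Local Notation leb := (@lebesgue_measure R).
Local Notation I := (`]c, d[%classic : set R).

Let avg (a b : R) : R := Rintegral mu setT (fun z => h ((b - z) / a)).

Let mh : measurable_fun setT h.
Proof. exact: continuous_measurable_fun. Qed.

Let mhab (a : R) : measurable_fun setT (fun bz : R * R => h ((bz.1 - bz.2) / a)).
Proof.
apply: measurableT_comp mh _; apply: measurable_funM => //.
exact: measurable_funB.
Qed.

Let M_ge0 : 0 <= M. Proof. exact: le_trans (h_le 0). Qed.

(** Measurability in [b] does not involve a measure on the [b] axis, so [mu] is put there too: it is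
    finite, which makes the constant bound [M] integrable. *)
Lemma measurable_avg a : measurable_fun setT (avg a).
Proof.
have [|||//] := @Fubini_dominated _ _ _ _ R mu mu (fun bz => h ((bz.1 - bz.2) / a)) (cst M).
- exact: mhab.
- exact: finite_measure_integrable_cst.
- by move=> x y; exact: h_le.
Qed.

Let mhb a b : measurable_fun setT (fun z : R => h ((b - z) / a)).
Proof.
apply: measurableT_comp mh _; apply: measurable_funM => //.
exact: measurable_funB.
Qed.

Lemma integrable_avg a b : mu.-integrable setT (EFin \o (fun z => h ((b - z) / a))).
Proof.
exact: (integrable_bounded mu _ M).
Qed.

Lemma avg_le a b : `|avg a b| <= M.
Proof.
apply: (le_trans (le_normr_Rintegral measurableT (integrable_avg a b))).
apply: (@le_trans _ _ (Rintegral mu setT (cst M))).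
  apply: le_Rintegral => //.
  - by apply: (integrable_norm (integrable_avg a b)).
  - exact: finite_measure_integrable_cst.
by rewrite Rintegral_cst// [X in fine X]probability_setT mulr1.
Qed.

Let m (y : R) : R := fine (mu [set y]).

(** At [z = y] the integrand is constantly [h t]. For [z != y] its argument [t + (y - z) / u n]
    escapes to infinity, where [xh_le] forces [h] to vanish. The constant [M] dominates. *)
Lemma cvg_avg (u : R^nat) y t : (forall n, 0 < u n) -> u n @[n --> \oo] --> 0 ->
  avg (u n) (y + u n * t) @[n --> \oo] --> h t * m y.
Proof.
move=> u0 u_0.
have -> : h t * m y = Rintegral mu setT (fun z => h t * \1_[set y] z).
  rewrite RintegralZl//; last first.
    by apply: (integrable_bounded mu _ 1) => // x; rewrite indicE ger0_norm//; case: (_ \in _).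
  by congr (_ * _); rewrite /m /Rintegral integral_indic// setIT.
have [||||_ //] := @Rintegral_dominated_cvg _ _ _ mu (fun n z => h ((y + u n * t - z) / u n))
  (fun z => h t * \1_[set y] z) (cst M).
- by move=> n; exact: mhb.
- move=> z; rewrite indicE; have [->|zy] := eqVneq z y.
    rewrite mem_set// mulr1; apply: cvg_near_cst; near=> n.
    by rewrite (_ : _ / _ = t)//; field; rewrite gt_eqF.
  rewrite memNset ?mulr0; last by apply/eqP.
  (* This is the reciprocal [w] of the argument of [h]; it tends to 0, and [xh_le] at [w^-1] bounds
     the value of [h] by [M * |w|]. *)
  have wc : (u n * t + (y - z))^-1 * u n @[n --> \oo] --> (0 * t + (y - z))^-1 * 0.
    apply: cvgM => //; apply: cvgV; first by rewrite mul0r add0r subr_eq0 eq_sym.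
    by apply: cvgD; [apply: cvgM => //; exact: cvg_cst|exact: cvg_cst].
  rewrite mulr0 in wc.
  apply/norm_cvg0P.
  have Mw : M * `|(u n * t + (y - z))^-1 * u n| @[n --> \oo] --> M * `|0 : R|.
    by apply: cvgM; [exact: cvg_cst|exact: (cvg_norm wc)].
  rewrite normr0 mulr0 in Mw.
  apply: (squeeze_cvgr _ (cvg_cst 0) Mw); near=> n; rewrite normr_ge0/=.
  have w0 : u n * t + (y - z) != 0.
    near: n; apply: (@cvgr_neq0 _ _ _ _ _ _ (0 * t + (y - z))).
      by apply: cvgD; [apply: cvgM => //; exact: cvg_cst|exact: cvg_cst].
    by rewrite mul0r add0r subr_eq0 eq_sym.
  have -> : (y + u n * t - z) / u n = ((u n * t + (y - z))^-1 * u n)^-1.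
    by field; rewrite w0 gt_eqF.
  have := xh_le ((u n * t + (y - z))^-1 * u n)^-1.
  set w := (_^-1 * u n); have w1 : w != 0 by rewrite mulf_neq0 ?invr_neq0// gt_eqF.
  by rewrite normrM normfV ler_pdivrMl ?normr_gt0// mulrC.
- exact: finite_measure_integrable_cst.
- by move=> n z; exact: h_le.
Unshelve. all: by end_near. Qed.

(** The contribution of a single point [y] to the rescaled energy, in the variable
    [t = (b - y) / a]. *)
Let slice (a y : R) : R :=
  Rintegral leb setT (fun t => \1_I (y + a * t) * h t * avg a (y + a * t)).

Lemma energy_slice a : 0 < a ->
  measurable_fun setT (slice a) /\
  a * Rintegral leb I (fun b => `|cwt h mu b a| ^+ 2) = Rintegral mu setT (slice a).
Proof.
move=> a0; have ai : 0 < a^-1 by rewrite invr_gt0.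
(* Squaring [cwt] yields two factors [a^-1]. The one kept in [F] cancels the Jacobian of
   [b = y + a t]; the other cancels the prefactor [a] of the energy. *)
pose F (p : R * R) := a^-1 * (\1_I p.1 * avg a p.1 * h ((p.1 - p.2) / a)).
have mF : measurable_fun setT F.
  apply: measurable_funM => //; apply: measurable_funM; last exact: mhab.
  apply: measurable_funM; first exact: measurableT_comp (measurable_indic _) _.
  exact: measurableT_comp (measurable_avg a) _.
(* Stated for any [z] bounded by [M] because it serves twice: with a value of [h], to dominate [F],
   and with [avg a b], to dominate its [mu]-integral. *)
have le_g b z : `|z| <= M ->
    `|a^-1 * (\1_I b * avg a b * z)| <= a^-1 * M ^+ 2 * \1_I b.
  move=> zM.
  have i0 : 0 <= \1_I b :> R by rewrite indicE.
  rewrite !normrM (gtr0_norm ai) (ger0_norm i0) -[leRHS]mulrA ler_pM2l//.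
  rewrite -mulrA [leRHS]mulrC ler_wpM2l// expr2.
  by apply: ler_pM => //; exact: avg_le.
have F_le b y : `|F (b, y)| <= a^-1 * M ^+ 2 * \1_I b by exact: le_g.
have ig : leb.-integrable setT (EFin \o (fun b => a^-1 * M ^+ 2 * \1_I b)).
  by apply: integrable_EFinZl; exact: integrable_indic_itv.
have [mF1 mF2 FE] := Fubini_dominated leb mu F _ mF ig F_le.
have iF y : leb.-integrable setT (EFin \o (fun b => F (b, y))).
  apply: le_integrable ig => //.
    by apply/measurable_EFinP; exact: measurableT_comp mF _.
  by move=> b _; rewrite lee_fin (le_trans (F_le _ _))// ler_norm.
have sliceE : (fun y => Rintegral leb setT (fun b => F (b, y))) = slice a.
  apply/funext => y; rewrite (Rintegral_affine _ y a a0)// -RintegralZl//; last first.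
    exact: (integrable_affine _ y a a0 _ (iF y)).
  apply: eq_Rintegral => t _; rewrite /F/= (_ : (y + a * t - y) / a = t).
    by field; rewrite gt_eqF.
  by field; rewrite gt_eqF.
rewrite -{1}sliceE; split; first exact: mF2.
have G b : Rintegral mu setT (fun y => F (b, y)) = a^-1 * (\1_I b * avg a b * avg a b).
  rewrite mulrA -RintegralZl//; last exact: integrable_avg.
  by apply: eq_Rintegral => y _; rewrite /F/= mulrA.
have cG : (fun b => `|cwt h mu b a| ^+ 2) \_ I =
    fun b => a^-1 * Rintegral mu setT (fun y => F (b, y)).
  apply/funext => b; rewrite G patchE indicE.
  case: ifPn => _; last by rewrite !mul0r !mulr0.
  by rewrite mul1r /cwt -/(avg a b) real_normK ?num_real//; ring.
have iG : leb.-integrable setT (EFin \o (fun b => Rintegral mu setT (fun y => F (b, y)))).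
  apply: le_integrable ig => //; first exact/measurable_EFinP.
  by move=> b _; rewrite lee_fin G (le_trans (le_g _ _ (avg_le _ _)))// ler_norm.
by rewrite -sliceE -FE Rintegral_mkcond cG RintegralZl// mulrA divff ?gt_eqF// mul1r.
Qed.

Let K := Rintegral leb setT (fun t => h t ^+ 2).
(** The pointwise limit of [\1_I (y + a * t)] as [a] decreases to 0. *)
Let w (y t : R) : R := \1_I y + \1_[set c] y * \1_(`]0, +oo[%classic) t
  + \1_[set d] y * \1_(`]-oo, 0[%classic) t.

Let iMh : leb.-integrable setT (EFin \o (fun t => M * `|h t|)).
Proof. by apply: integrable_EFinZl; exact: (integrable_norm ih). Qed.

Let ih2 : leb.-integrable setT (EFin \o (fun t => h t ^+ 2)).
Proof.
apply: le_integrable iMh => //.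
  by apply/measurable_EFinP; exact: measurable_funX.
move=> t _; rewrite lee_fin expr2 !normrM normr_id (ger0_norm M_ge0).
exact: ler_wpM2r.
Qed.

(** The majorant depends on neither [a] nor [y]: it dominates the integrals over [t], and its
    integral is a constant dominating the slices under [mu]. *)
Let slice_bound a y t : `|\1_I (y + a * t) * h t * avg a (y + a * t)| <= M * `|h t|.
Proof.
rewrite !normrM [leRHS]mulrC; apply: ler_pM => //; last exact: avg_le.
by rewrite -[leRHS]mul1r ler_wpM2r// indicE; case: (_ \in _); rewrite ?normr1 ?normr0.
Qed.

Let measurable_integrand a y :
  measurable_fun setT (fun t : R => \1_I (y + a * t) * h t * avg a (y + a * t)).
Proof.
have maff : measurable_fun setT (fun t : R => y + a * t) by exact: measurable_funD.
apply: measurable_funM; last exact: measurableT_comp (measurable_avg _) _.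
by apply: measurable_funM => //; exact: measurableT_comp (measurable_indic _) _.
Qed.

Lemma cvg_slice (u : R^nat) y : (forall n, 0 < u n) -> u n @[n --> \oo] --> 0 ->
  slice (u n) y @[n --> \oo] --> Rintegral leb setT (fun t => w y t * h t * (h t * m y)).
Proof.
move=> u0 u_0; apply: (proj2 (@Rintegral_dominated_cvg _ _ _ leb
  (fun n t => \1_I (y + u n * t) * h t * avg (u n) (y + u n * t)) _ _ _ _ iMh _)).
- by move=> n; exact: measurable_integrand.
- move=> t; apply: cvgM; last exact: cvg_avg.
  by apply: cvgM; [exact: cvg_indic_itvoo|exact: cvg_cst].
- by move=> n t; exact: slice_bound.
Qed.

Lemma slice_le a y : `|slice a y| <= Rintegral leb setT (fun t => M * `|h t|).
Proof.
have ia : leb.-integrable setT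
    (EFin \o (fun t => \1_I (y + a * t) * h t * avg a (y + a * t))).
  apply: le_integrable iMh => //; first by apply/measurable_EFinP; exact: measurable_integrand.
  by move=> t _; rewrite lee_fin (le_trans (slice_bound _ _ _))// ler_norm.
apply: (le_trans (le_normr_Rintegral measurableT ia)).
by apply: le_Rintegral => //; exact: (integrable_norm ia).
Qed.

(** Evenness of [h ^+ 2] gives half of [K] to the closed positive half-line, and removing the point
    0 changes nothing; the negative half-line receives what is left of [K]. *)
Lemma Rintegral_sqr_half :
  Rintegral leb setT (fun t => \1_(`]0, +oo[%classic) t * h t ^+ 2) = 2^-1 * K /\
  Rintegral leb setT (fun t => \1_(`]-oo, 0[%classic) t * h t ^+ 2) = 2^-1 * K.
Proof.
have indE (A : set R) : (fun t => \1_A t * h t ^+ 2) = (fun t => h t ^+ 2) \_ A.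
  apply/funext => t; rewrite patchE indicE.
  by case: ifPn => _; rewrite ?mul1r ?mul0r.
have mh2 : measurable_fun setT (fun t => h t ^+ 2) by exact: measurable_funX.
have Kpos : Rintegral leb `[0, +oo[ (fun t => h t ^+ 2) = 2^-1 * K.
  rewrite /K /Rintegral (@ge0_symfun_integralT _ (fun t => h t ^+ 2)).
  - rewrite -set_itvcy fineM//; first by rewrite mulrA mulVf// mul1r.
    by apply: integrable_fin_num => //; apply: integrableS ih2.
  - by move=> t; exact: sqr_ge0.
  - move=> t; apply: (@continuous_comp _ _ _ h (fun z => z ^+ 2)); first exact: ch.
    exact: exprn_continuous.
  - by move=> t; rewrite /= h_even.
split; rewrite indE -Rintegral_mkcond.
  by rewrite Rintegral_itv_obnd_cbnd//; apply: integrableS ih2.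
have KE : K = Rintegral leb `[0, +oo[ (fun t => h t ^+ 2) +
    Rintegral leb `]-oo, 0[ (fun t => h t ^+ 2).
  rewrite /K (_ : setT = `[0, +oo[ `|` `]-oo, 0[); last first.
    by rewrite -(setUv `[0, +oo[%classic) setCitvr.
  rewrite Rintegral_setU//.
    by apply: integrableS ih2 => //; exact: measurableU.
  by rewrite -setCitvr; exact/disj_setPCl.
have : K = 2^-1 * K + 2^-1 * K by lra.
by rewrite {1}KE Kpos => /addrI.
Qed.

(** The first term of [w] is constant in [t] and yields all of [K]; the two half-line terms yield
    [K / 2] each, whence the weights of the endpoints. *)
Lemma Rintegral_limit_slice y :
  Rintegral leb setT (fun t => w y t * h t * (h t * m y)) =
  K * (m y * (\1_I y + 2^-1 * \1_[set c] y + 2^-1 * \1_[set d] y)).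
Proof.
have [Kp Kn] := Rintegral_sqr_half.
have iI (A : set R) : measurable A ->
    leb.-integrable setT (EFin \o (fun t => \1_A t * h t ^+ 2)).
  move=> mA; apply: le_integrable ih2 => //.
    by apply/measurable_EFinP; apply: measurable_funM => //; exact: measurable_funX.
  move=> t _; rewrite lee_fin normrM -[leRHS]mul1r ler_wpM2r// indicE.
  by case: (_ \in _); rewrite ?normr1 ?normr0.
pose g1 t := (m y * \1_I y) * h t ^+ 2.
pose g2 t := (m y * \1_[set c] y) * (\1_(`]0, +oo[%classic) t * h t ^+ 2).
pose g3 t := (m y * \1_[set d] y) * (\1_(`]-oo, 0[%classic) t * h t ^+ 2).
have i1 : leb.-integrable setT (EFin \o g1) by exact: integrable_EFinZl.
have i2 : leb.-integrable setT (EFin \o g2) by apply: integrable_EFinZl; exact: iI.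
have i3 : leb.-integrable setT (EFin \o g3) by apply: integrable_EFinZl; exact: iI.
have i12 : leb.-integrable setT (EFin \o (fun t => g1 t + g2 t)).
  exact: integrable_EFinD.
have -> : (fun t => w y t * h t * (h t * m y)) = (fun t => g1 t + g2 t + g3 t).
  by apply/funext => t; rewrite /w /g1 /g2 /g3; ring.
rewrite RintegralD// RintegralD// /g1 /g2 /g3 !RintegralZl//; [|exact: iI|exact: iI].
by rewrite Kp Kn -/K; ring.
Qed.

Lemma Rintegral_atoms :
  Rintegral mu setT (fun y => K * (m y * (\1_I y + 2^-1 * \1_[set c] y + 2^-1 * \1_[set d] y))) =
  K * (fine (\esum_(x in I) (mu [set x] * mu [set x]))%E + 2^-1 * (m c * m c + m d * m d)).
Proof.
have mm : measurable_fun setT m.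
  by apply: measurableT_comp (measurable_atom_mass _ mu).
have m0 y : 0 <= m y by exact: fine_ge0.
have m1 y : m y <= 1 by rewrite -lee_fin /m fineK ?fin_num_measure// probability_le1.
have iI (A : set R) : measurable A -> mu.-integrable setT (EFin \o (fun y => m y * \1_A y)).
  move=> mA; apply: (integrable_bounded mu _ 1).
    by apply: measurable_funM.
  move=> y; rewrite normrM (ger0_norm (m0 _)) indicE.
  by case: (_ \in _); rewrite ?normr1 ?normr0 ?mulr1 ?mulr0.
have ab (A : set R) : measurable A ->
    Rintegral mu setT (fun y => m y * \1_A y) = fine (\int[mu]_(y in A) mu [set y])%E.
  move=> mA; rewrite /Rintegral [in RHS]integral_mkcond; congr fine.
  apply: eq_integral => y _; rewrite patchE indicE; case: ifPn => _.
    by rewrite mulr1 /m fineK// fin_num_measure.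
  by rewrite mulr0.
(* The atom sum over a singleton has one term, which gives the squared endpoint masses. *)
have single x : Rintegral mu setT (fun y => m y * \1_[set x] y) = m x * m x.
  rewrite ab// integral_atom_mass// esum_set1 ?mule_ge0//.
  by rewrite fineM// fin_num_measure.
pose g1 y := K * (m y * \1_I y).
pose g2 y := (K * 2^-1) * (m y * \1_[set c] y).
pose g3 y := (K * 2^-1) * (m y * \1_[set d] y).
have i1 : mu.-integrable setT (EFin \o g1) by apply: integrable_EFinZl; exact: iI.
have i2 : mu.-integrable setT (EFin \o g2) by apply: integrable_EFinZl; exact: iI.
have i3 : mu.-integrable setT (EFin \o g3) by apply: integrable_EFinZl; exact: iI.
have i12 : mu.-integrable setT (EFin \o (fun t => g1 t + g2 t)).
  exact: integrable_EFinD.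
rewrite (_ : (fun y => _) = (fun y => g1 y + g2 y + g3 y)); last first.
  by apply/funext => y; rewrite /g1 /g2 /g3; ring.
rewrite RintegralD// RintegralD// /g1 /g2 /g3 !RintegralZl//; try exact: iI.
by rewrite !single ab// integral_atom_mass//; ring.
Qed.

Lemma energy_cvg :
  a * Rintegral leb I (fun b => `|cwt h mu b a| ^+ 2) @[a --> 0^'+] -->
  K * (fine (\esum_(x in I) (mu [set x] * mu [set x]))%E + 2^-1 * (m c * m c + m d * m d)).
Proof.
(* Dominated convergence is about sequences, so the right limit is tested along positive sequences
   tending to 0. *)
apply/cvg_at_rightP => u [u0 u_0].
rewrite (_ : (fun n => _) = (fun n => Rintegral mu setT (slice (u n)))); last first.
  by apply/funext => n; have [_ ->] := energy_slice _ (u0 n).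
rewrite -Rintegral_atoms.
apply: (proj2 (@Rintegral_dominated_cvg _ _ _ mu (fun n => slice (u n)) _
  (cst (Rintegral leb setT (fun t => M * `|h t|))) _ _ _ _)).
- by move=> n; have [] := energy_slice _ (u0 n).
- by move=> y; rewrite -Rintegral_limit_slice; exact: cvg_slice.
- exact: finite_measure_integrable_cst.
- by move=> n y; exact: slice_le.
Qed.

End wavelet_energy.

(** * From [psi] to the kernel [hfun psi], and the conclusion *)

Lemma derive1_even (R : realType) (f : R -> R) (x : R) :
  (forall x, derivable f x 1) -> (forall x, f (- x) = f x) ->
  derive1 f (- x) = - derive1 f x.
Proof.
move=> df f_even.
have E : f = f \o -%R by apply/funext => z; rewrite /= f_even.
have : derive1 (f \o -%R) x = derive1 f (- x) * derive1 (-%R : R -> R) x.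
  by rewrite derive1_comp.
by rewrite -E => ->; rewrite derive1N// derive1_id mulrN1 opprK.
Qed.

Theorem theorem2p8 (R : realType) (psi : R -> R)
  (psi_der : forall x, derivable psi x 1)
  (psi'_cont : continuous (derive1 psi))
  (psi0 : psi 0 = 1)
  (psi_even : forall x, psi (- x) = psi x)
  (psi_decay : exists C : R, exists delta : R, 0 < C /\ 1 < delta /\
     forall x, `|psi x| + `|x * derive1 psi x| <= C * jbr x `^ (- delta))
  (A_psi_neq0 : (\int[@lebesgue_measure R]_x (psi x)%:E != 0)%E)
  (mu : probability R R) (c d : R) (cd : c < d) :
  ((a * Rintegral (@lebesgue_measure R) `]c, d[
        (fun b => `|cwt (hfun psi) mu b a| ^+ 2))%:E
     @[a --> 0^'+] -->
   ((Cconst (hfun psi))%:E *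
     (\esum_(x in `]c, d[) (mu [set x] * mu [set x])
      + (2^-1)%:E * (mu [set c] * mu [set c] + mu [set d] * mu [set d])))%E).
Proof.
have [C [delta [C0 [delta1 psi_le]]]] := psi_decay.
have j1 (x : R) : 1 <= jbr x by exact: jbr_ge1.
have h_le_jbr x : `|hfun psi x| <= C * jbr x `^ (- delta).
  exact: le_trans (ler_normD _ _) (psi_le x).
(* As the bracket is at least 1, the exponent [delta] may be lowered to 1. This gives both bounds
   required of the kernel with [M = C]; the full exponent serves for integrability. *)
have jV x : jbr x `^ (- delta) <= (jbr x)^-1.
  rewrite -powR_inv1; last by rewrite (le_trans ler01).
  by apply: ler_powR => //; rewrite lerN2 ltW.
have h_le x : `|hfun psi x| <= C.
  apply: (le_trans (h_le_jbr x)); rewrite -[leRHS]mulr1 ler_wpM2l ?(ltW C0)//.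
  by apply: (le_trans (jV x)); rewrite invf_le1// (lt_le_trans ltr01).
have xh_le x : `|x * hfun psi x| <= C.
  have jx : 0 < jbr x by rewrite (lt_le_trans ltr01).
  rewrite normrM (@le_trans _ _ (jbr x * (C * (jbr x)^-1)))//.
    apply: ler_pM => //; first exact: jbr_ge_norm.
    by apply: (le_trans (h_le_jbr x)); rewrite ler_wpM2l// ltW.
  by rewrite mulrCA divff ?gt_eqF// mulr1.
have ch : continuous (hfun psi).
  move=> x; apply: cvgD; first exact/differentiable_continuous/derivable1_diffP/psi_der.
  by apply: cvgM; [exact: cvg_id|exact: psi'_cont].
have h_even x : hfun psi (- x) = hfun psi x.
  by rewrite /hfun derive1_even// psi_even mulrNN.
have ih : lebesgue_measure.-integrable [set: R] (EFin \o hfun psi).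
  have ij := integrableZl measurableT C (integrable_jbr_powR R delta delta1).
  apply: le_integrable ij => //.
    by apply/measurable_EFinP; exact: continuous_measurable_fun.
  by move=> x _; rewrite -EFinM lee_fin (le_trans (h_le_jbr x))// ler_norm.
have := energy_cvg _ _ mu _ _ ch h_le xh_le h_even ih cd.
set S := (\esum_(x in _) _)%E; set L := (X in _ --> X) => cvgE.
(* The atom sum is the integral of [mu{x}] over the interval, hence at most 1. Finiteness allows the
   real limit to be read in the extended reals. *)
have Sfin : S \is a fin_num.
  rewrite /S -integral_atom_mass// ge0_fin_numE; last exact: integral_ge0.
  apply: (@le_lt_trans _ _ (\int[mu]_(x in `]c, d[) 1)%E).
    apply: ge0_le_integral => //.
      by apply: measurable_funTS; exact: measurable_atom_mass.
    by move=> x _; exact: probability_le1.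
  by rewrite integral_cst// mul1e (le_lt_trans (probability_le1 mu (measurable_itv _)))// ltry.
have KE : Cconst (hfun psi) = Rintegral lebesgue_measure setT (fun t => hfun psi t ^+ 2).
  by apply: eq_Rintegral => t _; rewrite real_normK ?num_real.
have atomE x : (mu [set x] * mu [set x] = (fine (mu [set x]) * fine (mu [set x]))%:E)%E.
  by rewrite EFinM fineK// fin_num_measure.
rewrite !atomE -[S]fineK// [X in _ --> X](_ : _ = L%:E); last by rewrite KE.
by apply: cvg_EFin; [exact: nearW|exact: cvgE].
Qed.
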